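(* Let $(X,T)$ be an invertible t.d.s. If $(K(X),T_K)$ is pointwise recurrent, then the topological entropy of $(K(X),T_K)$ is zero: $h_{\mathrm{top}}(K(X),T_K)=0$.
   Context: An invertible t.d.s. is a pair $(X,T)$ with $X$ a compact metric space and $T:X\to X$ a homeomorphism. $K(X)$ is the set of non-empty closed subsets of $X$ with the Hausdorff metric, and $T_K:K(X)\to K(X)$, $T_K(A)=T(A)$; $(K(X),T_K)$ is again an invertible t.d.s. For an invertible t.d.s. $(X,T)$, a point $x$ is recurrent if there is a sequence of integers $n_i\to+\infty$ or a sequence $n_i\to-\infty$ with $T^{n_i}x\to x$; the system is pointwise recurrent if every point is recurrent. $h_{\mathrm{top}}$ denotes topological entropy. *)

(* Defs.v *)
From HB Require Import structures.
From mathcomp Require Import all_boot all_order all_algebra.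
From mathcomp Require Import all_classical all_reals all_analysis.

Set Implicit Arguments.
Unset Strict Implicit.
Unset Printing Implicit Defensive.

Import Order.TTheory GRing.Theory Num.Theory.
Import numFieldTopology.Exports.

Local Open Scope classical_set_scope.
Local Open Scope ring_scope.

HB.mixin Record Metric_isCompact (R : numDomainType) X & Metric R X := {
  compact_setT : compact [set: X]
}.

(* The empty space is not excluded. *)
#[short(type="compactMetricType")]
HB.structure Definition CompactMetric (R : numDomainType) :=
  { X of Metric R X & Metric_isCompact R X }.

Record homeomorphism (X : topologicalType) := Homeomorphism {
  homeo_fun :> X -> X ;
  homeo_inv : X -> X ;
  homeo_continuous : continuous homeo_fun ;
  homeo_inv_continuous : continuous homeo_inv ;
  homeo_funK : cancel homeo_fun homeo_inv ;
  homeo_invK : cancel homeo_inv homeo_fun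
}.

(* Negz k is - k.+1. *)
Definition homeo_exp (X : topologicalType) (T : homeomorphism X) (n : int) :
    X -> X :=
  match n with
  | Posz k => iter k T
  | Negz k => iter k.+1 (homeo_inv T)
  end.

Definition recurrent (X : topologicalType) (T : homeomorphism X) (x : X) :=
  exists n_ : nat -> int,
    ((forall M : int, \forall i \near \oo, M <= n_ i) \/
     (forall M : int, \forall i \near \oo, n_ i <= M)) /\
    homeo_exp T (n_ i) x @[i --> \oo] --> x.

Definition pointwise_recurrent (X : topologicalType) (T : homeomorphism X) :=
  forall x : X, recurrent T x.

Section compact_metric.
Context {R : realType} {X : compactMetricType R}.

Lemma mdist_bounded (y : X) : exists M : R, forall x, mdist y x <= M.
Proof.
have /compact_near_coveringP cX := @compact_setT R X.
suff /filter_ex[M hM] : \forall M \near +oo%R, forall x : X, mdist y x <= M.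
  by exists M.
have := cX R +oo%R (fun M x => mdist y x <= M) _.
have H x : [set: X] x ->
    \forall x' \near x & M \near +oo%R, mdist y x' <= M.
  move=> _; exists (ball x 1, [set M | mdist y x + 1 <= M]) => /=.
    split; first exact: nbhsx_ballx.
    exact: nbhs_pinfty_ge (num_real _).
  move=> [x' M] /= [+ h]; rewrite ballEmdist /= => xx'.
  apply: le_trans h; apply: (le_trans (metric_triangle y x x')).
  by rewrite lerD2l ltW.
by move=> /(_ _ H); apply: filterS => M h x; exact: h.
Qed.

Lemma unif_cont (f : X -> X) : continuous f -> forall e : R, 0 < e ->
  exists2 d : R, 0 < d &
    forall x y, mdist x y < d -> mdist (f x) (f y) < e.
Proof.
move=> cf e e0; have /compact_near_coveringP cX := @compact_setT R X.
have := cX R (0^'+)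
  (fun d x => forall y, mdist x y < d -> mdist (f x) (f y) < e) _.
have H x : [set: X] x -> \forall x' \near x & d \near (0:R)^'+,
    forall y, mdist x' y < d -> mdist (f x') (f y) < e.
  move=> _; have e20 : 0 < e / 2 by rewrite divr_gt0.
  have := cf x _ (nbhsx_ballx (f x) _ e20); rewrite nbhs_simpl /=.
  move=> /nbhs_ballP[r /= r0 rf].
  have r20 : 0 < r / 2 by rewrite divr_gt0.
  exists (ball x (r / 2), [set d | d < r / 2]) => /=.
    split; first exact: nbhsx_ballx.
    exact: nbhs_right_lt.
  move=> [x' d] /= [xx' dr] y x'y.
  have fx' : ball (f x) (e / 2) (f x').
    by apply: rf; apply: le_ball xx'; rewrite ler_pdivrMr// ler_pMr// ler1n.
  have fy : ball (f x) (e / 2) (f y).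
    apply: rf; have := xx'; rewrite !ballEmdist /= => {}xx'.
    apply: (le_lt_trans (metric_triangle x x' y)).
    by rewrite (splitr r) ltrD// (lt_trans x'y).
  have := ball_splitr fx' fy; by rewrite ballEmdist.
move=> /(_ _ H) h.
near (0:R)^'+ => d; exists d; first by [].
by move=> x; apply: (near h d) => //.
Unshelve. all: by end_near. Qed.

End compact_metric.

Record hyperspace (X : topologicalType) := Hyperspace {
  hyper_set :> set X ;
  hyper_closed : closed hyper_set ;
  hyper_nonempty : hyper_set !=set0
}.

Lemma hyperspace_eq (X : topologicalType) (A B : hyperspace X) :
  hyper_set A = hyper_set B -> A = B.
Proof.
case: A B => [A cA A0] [B cB B0] /= AB; subst B.
by rewrite (Prop_irrelevance cA cB) (Prop_irrelevance A0 B0).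
Qed.

HB.instance Definition _ (X : topologicalType) := gen_eqMixin (hyperspace X).
HB.instance Definition _ (X : topologicalType) :=
  gen_choiceMixin (hyperspace X).

Section hausdorff_distance.
Context {R : realType} {X : compactMetricType R}.
Implicit Types A B C : hyperspace X.

Definition point_dist (x : X) (B : set X) : R := inf [set mdist x b | b in B].

Definition hausdorff_excess (A B : set X) : R :=
  sup [set point_dist a B | a in A].

Definition hausdorff_dist (A B : set X) : R :=
  Num.max (hausdorff_excess A B) (hausdorff_excess B A).

Let dist_lb x (B : set X) : has_lbound [set mdist x b | b in B].
Proof. by exists 0 => _ [b _ <-]; exact: mdist_ge0. Qed.

Lemma point_dist_le x (B : set X) b : B b -> point_dist x B <= mdist x b.
Proof. by move=> Bb; apply: ge_inf => //; exists b. Qed.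

Lemma point_dist_ge x B (e : R) :
  (forall b, hyper_set B b -> e <= mdist x b) -> e <= point_dist x B.
Proof.
move=> h; apply: lb_le_inf.
  by have [b Bb] := hyper_nonempty B; exists (mdist x b), b.
by move=> _ [b Bb <-]; exact: h.
Qed.

Lemma point_dist_lt x B (e : R) :
  point_dist x B < e -> exists2 b, hyper_set B b & mdist x b < e.
Proof.
move=> h; apply: contrapT => nh; move: h; apply/negP; rewrite -leNgt.
apply: point_dist_ge => b Bb; rewrite leNgt; apply/negP => xb.
by apply: nh; exists b.
Qed.

Lemma excess_ge A B a : hyper_set A a -> point_dist a B <= hausdorff_excess A B.
Proof.
move=> Aa; apply: ub_le_sup; last by exists a.
have [b Bb] := hyper_nonempty B.
have [M hM] := mdist_bounded b; exists M => _ [x Ax <-].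
by apply: (le_trans (point_dist_le _ Bb)); rewrite metric_sym.
Qed.

Lemma excess_le A B (e : R) :
  (forall a, hyper_set A a -> point_dist a B <= e) -> hausdorff_excess A B <= e.
Proof.
move=> h; apply: ge_sup; last by move=> _ [a Aa <-]; exact: h.
by have [a Aa] := hyper_nonempty A; exists (point_dist a B), a.
Qed.

Lemma hausdorff_dist_le A B (e : R) :
  (forall a, hyper_set A a -> exists2 b, hyper_set B b & mdist a b <= e) ->
  (forall b, hyper_set B b -> exists2 a, hyper_set A a & mdist b a <= e) ->
  hausdorff_dist A B <= e.
Proof.
move=> AB BA; rewrite /hausdorff_dist ge_max; apply/andP; split.
  apply: excess_le => a /AB[b Bb ab]; exact: le_trans (point_dist_le _ Bb) ab.
apply: excess_le => b /BA[a Aa ab]; exact: le_trans (point_dist_le _ Aa) ab.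
Qed.

Lemma hausdorff_distC A B : hausdorff_dist A B = hausdorff_dist B A.
Proof. by rewrite /hausdorff_dist maxC. Qed.

Lemma hausdorff_dist_lt A B (e : R) : hausdorff_dist A B < e ->
  forall a, hyper_set A a -> exists2 b, hyper_set B b & mdist a b < e.
Proof.
rewrite /hausdorff_dist gt_max => /andP[h _] a Aa; apply: point_dist_lt.
exact: le_lt_trans (excess_ge B Aa) h.
Qed.

Lemma hausdorff_distxx A : hausdorff_dist A A = 0.
Proof.
apply/eqP; rewrite eq_le; apply/andP; split.
  by apply: hausdorff_dist_le => a Aa; exists a => //; rewrite mdistxx.
have [a Aa] := hyper_nonempty A.
rewrite /hausdorff_dist le_max; apply/orP; left.
apply: le_trans (excess_ge A Aa).
by apply: point_dist_ge => b _; exact: mdist_ge0.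
Qed.

Lemma hausdorff_dist0 A B : hausdorff_dist A B = 0 -> A = B.
Proof.
suff sub (C D : hyperspace X) : hausdorff_dist C D = 0 -> hyper_set C `<=` hyper_set D.
  move=> h; apply: hyperspace_eq; apply/seteqP; split; first exact: sub.
  by apply: sub; rewrite hausdorff_distC.
move=> h x Cx; apply: (@hyper_closed _ D) => U /nbhs_ballP[e /= e0 eU].
have [|y Dy xy] := @hausdorff_dist_lt C D e _ x Cx; first by rewrite h.
by exists y; split => //; apply: eU; rewrite ballEmdist.
Qed.

Lemma hausdorff_dist_triangle B A C :
  hausdorff_dist A C <= hausdorff_dist A B + hausdorff_dist B C.
Proof.
suff tri (D E F : hyperspace X) : hausdorff_excess D F <=
    hausdorff_excess D E + hausdorff_excess E F.
  rewrite {1}/hausdorff_dist ge_max; apply/andP; split.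
    by apply: (le_trans (tri A B C)); rewrite lerD// le_max lexx.
  apply: (le_trans (tri C B A)); rewrite addrC.
  by rewrite lerD// le_max lexx orbT.
apply: excess_le => d Dd; rewrite -lerBlDr.
apply: le_trans (excess_ge E Dd); apply: point_dist_ge => x Ex.
rewrite lerBlDr; apply/ler_addgt0Pr => e e0.
have [|y Fy xy] := @point_dist_lt x F (hausdorff_excess E F + e).
  by apply: le_lt_trans (excess_ge F Ex) _; rewrite ltrDl.
apply: (le_trans (point_dist_le d Fy)).
by apply: (le_trans (metric_triangle d x y)); rewrite -addrA lerD2l ltW.
Qed.

HB.instance Definition _ := @isMetric.Build R (hyperspace X)
  (fun A B => hausdorff_dist A B)
  hausdorff_distxx hausdorff_dist0 hausdorff_distC hausdorff_dist_triangle.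

Lemma mdist_hyperE A B : mdist A B = hausdorff_dist A B.
Proof. by []. Qed.

Lemma hyperspace_compact : compact [set: hyperspace X].
Proof.
rewrite compact_ultra => F UF _.
pose meets x (r : R) : set (hyperspace X) :=
  [set A | exists2 a, hyper_set A a & mdist x a < r].
pose L : set X := [set x | forall r, 0 < r -> F (meets x r)].
have meetsS x y r s : mdist y x + r <= s -> meets x r `<=` meets y s.
  move=> h A [a Aa xa]; exists a => //.
  apply: (le_lt_trans (metric_triangle y x a)); apply: lt_le_trans h.
  by rewrite ltrD2l.
have LN x : ~ L x -> exists2 r, 0 < r & F (~` meets x r).
  move=> nL; apply: contrapT => nh; apply: nL => r r0.
  by have [//|h] := in_ultra_setVsetC (meets x r) UF; case: nh; exists r.
have farN x y r : mdist x y < r -> F (~` meets x r) -> ~ L y.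
  move=> xy Fx Ly; have r0 : 0 < r - mdist x y by rewrite subr_gt0.
  have FI : F (~` meets x r `&` meets y (r - mdist x y)).
    exact: filterI Fx (Ly _ r0).
  have [A [nA mA]] := filter_ex FI.
  by apply: nA; apply: meetsS mA; rewrite addrC subrK.
have cL : closed L.
  move=> x clx; apply: contrapT => /LN[r r0 Fr].
  have [y [Ly]] := clx _ (nbhsx_ballx x r r0).
  by rewrite ballEmdist /= => xy; apply: (farN x y r).
have /compact_near_coveringP cX := @compact_setT R X.
have key e : 0 < e -> \forall A \near F, forall x : X,
    (hyper_set A x -> exists2 l, L l & mdist x l < e) /\
    (L x -> exists2 a, hyper_set A a & mdist x a < e).
  move=> e0; have e20 : 0 < e / 2 by rewrite divr_gt0.
  have := cX _ F (fun A x =>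
    (hyper_set A x -> exists2 l, L l & mdist x l < e) /\
    (L x -> exists2 a, hyper_set A a & mdist x a < e)) _.
  have H x : [set: X] x -> \forall x' \near x & A \near F,
      (hyper_set A x' -> exists2 l, L l & mdist x' l < e) /\
      (L x' -> exists2 a, hyper_set A a & mdist x' a < e).
    move=> _; have [Lx|/LN[r r0 Fr]] := pselect (L x).
      exists (ball x (e / 2), meets x (e / 2)) => /=.
        by split; [exact: nbhsx_ballx|exact: Lx].
      move=> [x' A] /= [+ mA]; rewrite ballEmdist /= => xx'; split=> _.
        exists x => //; rewrite metric_sym (lt_trans xx')//.
        by rewrite ltr_pdivrMr// ltr_pMr// ltr1n.
      by apply: meetsS mA; rewrite metric_sym [leRHS]splitr lerD2r ltW.
    exists (ball x r, ~` meets x r) => /=; first by split; [exact: nbhsx_ballx|].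
    move=> [x' A] /= [+ nA]; rewrite ballEmdist /= => xx'; split.
      by move=> Ax'; case: nA; exists x'.
    by move=> Lx'; case: (farN x x' r).
  by move=> /(_ _ H); apply: filterS => A h x; exact: h.
have L0 : L !=set0.
  have /filter_ex[A hA] := key 1 ltr01.
  have [a Aa] := hyper_nonempty A.
  by have [l Ll _] := (hA a).1 Aa; exists l.
exists (Hyperspace cL L0); split => //=.
apply/metricType_numDomainType.fcvgrPdist_lt => e e0.
have e20 : 0 < e / 2 by rewrite divr_gt0.
have := key _ e20; apply: filterS => A hA; rewrite mdist_hyperE.
apply: (@le_lt_trans _ _ (e / 2)); last first.
  by rewrite ltr_pdivrMr// ltr_pMr// ltr1n.
apply: hausdorff_dist_le => /= x hx.
  by have [a Aa xa] := (hA x).2 hx; exists a => //; exact: ltW.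
by have [l Ll xl] := (hA x).1 hx; exists l => //; exact: ltW.
Qed.

HB.instance Definition _ :=
  @Metric_isCompact.Build R (hyperspace X) hyperspace_compact.

End hausdorff_distance.

Section hyper_map.
Context {R : realType} {X : compactMetricType R}.

Lemma image_closed (f : X -> X) (A : set X) :
  continuous f -> closed A -> closed (f @` A).
Proof.
move=> cf cA; apply: compact_closed; first exact: metric_hausdorff.
apply: continuous_compact; first exact: continuous_subspaceT.
by apply: subclosed_compact cA (@compact_setT R X) _.
Qed.

Definition hyper_map (f : X -> X) (cf : continuous f) (A : hyperspace X) :
    hyperspace X :=
  Hyperspace (image_closed cf (@hyper_closed _ A))
    (image_nonempty f (hyper_nonempty A)).

Lemma hyper_map_continuous (f : X -> X) (cf : continuous f) :
  continuous (hyper_map cf).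
Proof.
move=> A; have FA := @nbhs_filter (hyperspace X) A.
apply/metricType_numDomainType.cvgrPdist_le => e e0.
have [d d0 fd] := unif_cont cf e0.
apply: filterS (nbhsx_ballx A d d0) => B; rewrite ballEmdist /= => AB.
apply: hausdorff_dist_le => _ [x hx <-].
  have [y By xy] := hausdorff_dist_lt AB hx.
  by exists (f y); [exists y|apply/ltW/fd].
have [|y Ay xy] := @hausdorff_dist_lt _ _ B A d _ x hx.
  by rewrite hausdorff_distC.
by exists (f y); [exists y|apply/ltW/fd].
Qed.

Lemma hyper_mapK (f g : X -> X) (cf : continuous f) (cg : continuous g) :
  cancel f g -> cancel (hyper_map cf) (hyper_map cg).
Proof.
move=> fK A; apply: hyperspace_eq => /=.
apply/seteqP; split=> [_ [_ [x Ax <-] <-]|x Ax]; first by rewrite fK.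
by exists (f x); [exists x|exact: fK].
Qed.

Definition hyper_homeo (T : homeomorphism X) : homeomorphism (hyperspace X) :=
  Homeomorphism
    (hyper_map_continuous (cf := @homeo_continuous _ T))
    (hyper_map_continuous (cf := @homeo_inv_continuous _ T))
    (hyper_mapK _ _ (@homeo_funK _ T)) (hyper_mapK _ _ (@homeo_invK _ T)).

End hyper_map.

(* Topological entropy in the sense of Adler, Konheim and McAndrew; a family of
   sets is a set of sets. *)
Section entropy.
Context {X : topologicalType}.
Implicit Types U V : set (set X).

Definition open_cover U :=
  (forall A, U A -> open A) /\ \bigcup_(A in U) A = [set: X].

Definition cover_join U V : set (set X) := [set A `&` B | A in U & B in V].

Definition cover_preimage (f : X -> X) U : set (set X) :=
  [set f @^-1` A | A in U].

Definition iter_join (f : X -> X) U (n : nat) : set (set X) :=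
  \big[cover_join/[set [set: X]]]_(i < n) cover_preimage (iter i f) U.

Definition subcover_size U : set nat :=
  [set n | exists V, [/\ V `<=` U, (V #= `I_n)%card & \bigcup_(A in V) A = [set: X]]].

(* Meaningful when U has a finite subcover, as every open cover of a compact
   space does; the default 0 is returned otherwise. *)
Definition min_subcover (U : set (set X)) : nat :=
  xget 0%N [set n | subcover_size U n /\
                    forall m, subcover_size U m -> (n <= m)%N].

End entropy.

Section entropy_compact.
Context {R : realType} {X : compactMetricType R}.
Local Open Scope ereal_scope.

(* The limit exists by subadditivity, so the limsup is the limit.  When X is
   empty, min_subcover is 0 and ln 0 = 0, so that the entropy is 0. *)
Definition cover_entropy (f : X -> X) (U : set (set X)) : \bar R :=
  limn_esup (fun n => (ln (min_subcover (iter_join f U n))%:R / n%:R)%:E).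

Definition top_entropy (f : X -> X) : \bar R :=
  ereal_sup [set cover_entropy f U | U in open_cover].

End entropy_compact.

(* Main.v *)
(* Cover X by finitely many closed e-balls A.  Since A is recurrent in K(X),
   for every m there are times s_1 < ... < s_m such that T^(s_b - s_c) A lies in
   the e-neighbourhood of A for all c < b (or the same with T^-1).  So a
   visit of a closed set C to A at time i forces visits to the neighbourhood of
   A at the times i + s_b - s_c, and the visits of C to A during [0, n[ are
   determined, up to e, by a subset G of them having no difference of the form
   s_b - s_c.  The translates G + s_b are disjoint, hence G has density about
   1/m.  As T^i C is known up to 3e once its visits to all the balls are, the
   number of orbit segments of length n in K(X) is at most a fixed power of the
   number of subsets of [0, n[ of density 1/m, whose exponential growth rate
   vanishes as m grows. *)
Require Import Defs.
From mathcomp Require Import all_boot all_order all_algebra.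
From mathcomp Require Import all_classical all_reals all_analysis.
From mathcomp Require Import zify ring lra.

Set Implicit Arguments.
Unset Strict Implicit.
Unset Printing Implicit Defensive.

Import Order.TTheory GRing.Theory Num.Theory.
Import numFieldNormedType.Exports.

Local Open Scope classical_set_scope.
Local Open Scope ring_scope.

(** * Sets of times without prescribed gaps *)

(** Greedy choice: an element of least [key] in [E] has no [r]-predecessor there, so it joins [G],
    its successors are discarded, and the rest is treated in the same way. *)
Lemma kernel_exists (I : finType) (r : rel I) (key : I -> nat) (E : {set I}) :
  (forall i j, r i j -> (key i < key j)%N) ->
  exists G : {set I}, [/\ G \subset E,
    forall j, j \in E -> j \in G \/ exists2 i, i \in G & r i j &
    forall i j, i \in G -> j \in G -> ~~ r i j].
Proof.
move=> rkey; have [n] := ubnP #|E|; elim: n => // n IH in E *.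
have [->|[x0 x0E]] := set_0Vmem E.
  by exists finset.set0; split=> [|j|i j]; rewrite ?sub0set// inE.
rewrite ltnS => En; case: (arg_minnP key x0E) => x xE xmin.
have {}xE : x \in E by [].
pose E1 := (E :\ x) :\: [set j | r x j]%SET.
have [|G [/fintype.subsetP GE Gd Gi]] := IH E1.
  apply: leq_trans En; apply: leq_ltn_trans (_ : _ <= #|E :\ x|)%N _.
    exact/subset_leq_card/finset.subsetDl.
  by rewrite [X in (_ < X)%N](cardsD1 x) xE.
exists (x |: G)%SET; split.
- apply/fintype.subsetP => y; rewrite !inE => /orP[/eqP->//|/GE].
  by rewrite !inE => /and3P[].
- move=> j jE; have [->|jx] := eqVneq j x; first by left; rewrite !inE eqxx.
  have [xj|xj] := boolP (r x j); first by right; exists x; rewrite // !inE eqxx.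
  case: (Gd j); rewrite ?inE ?jx ?jE ?andbT//.
    by move=> ->; left; rewrite orbT.
  by move=> [i iG ij]; right; exists i; rewrite // !inE iG orbT.
- have rG j : j \in G -> ~~ r j x.
    move=> /GE; rewrite !inE => /and3P[_ _ jE]; apply/negP => /rkey.
    by rewrite ltnNge xmin.
  move=> i j; rewrite !inE => /orP[/eqP->|iG] /orP[/eqP->|jG].
  + by apply/negP => /rkey; rewrite ltnn.
  + by move: jG => /GE; rewrite !inE => /and3P[].
  + exact: rG.
  + exact: Gi.
Qed.

(** The differences b - c are written with sums because subtraction on [nat] truncates. *)
Definition gap_rel (s : seq nat) (i j : nat) :=
  (i < j)%N && has (fun b => has (fun c => i + b == j + c)%N s) s.

Lemma gap_relP s i j : gap_rel s i j ->
  exists b c, [/\ b \in s, c \in s, (c < b)%N & j = (i + (b - c))%N].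
Proof.
move=> /andP[ij /hasP[b bs /hasP[c cs /eqP e]]].
by exists b, c; split => //; lia.
Qed.

(** The sums i + b are pairwise distinct, since i + b = j + c with i < j would be a gap, and all lie
    below n + S. *)
Lemma gap_free_card (s : seq nat) (S n : nat) (G : {set 'I_n}) :
  uniq s -> (forall b, b \in s -> (b <= S)%N) ->
  (forall i j : 'I_n, i \in G -> j \in G -> ~~ gap_rel s i j) ->
  (#|G| * size s <= n + S)%N.
Proof.
move=> us sS hG.
pose t := [seq (i + b)%N | i : 'I_n <- enum G, b <- s].
rewrite cardE -(size_allpairs (fun (i : 'I_n) b => i + b)%N) -(size_iota 0 (n + S)).
apply: uniq_leq_size; last first.
  move=> _ /allpairsP[[i b] /= [_ bs ->]]; rewrite mem_iota.
  by have := ltn_ord i; have := sS _ bs; lia.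
apply: allpairs_uniq => //; first exact: enum_uniq.
move=> _ _ /allpairsP[[i b] /= [iG bs ->]] /allpairsP[[j c] /= [jG cs ->]] /= e.
rewrite !mem_enum in iG jG.
have [ij|ij|/ord_inj ij] := ltngtP i j.
- have := hG _ _ iG jG; rewrite /gap_rel ij /= => /hasP[]; exists b => //.
  by apply/hasP; exists c => //; exact/eqP.
- have := hG _ _ jG iG; rewrite /gap_rel ij /= => /hasP[]; exists c => //.
  by apply/hasP; exists b => //; exact/eqP.
- by subst j; move/addnI: e => ->.
Qed.

(** When (1 + t)^n is expanded over all subsets, each small [G] contributes at least t^r because t
    <= 1. *)
Lemma small_sets_card (R : realType) (n r : nat) (t : R) : 0 < t <= 1 ->
  #|[set G : {set 'I_n} | (#|G| <= r)%N]%SET|%:R <= (1 + t) ^+ n * t ^- r.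
Proof.
move=> /andP[t0 t1]; rewrite ler_pdivlMr ?exprn_gt0//.
have -> : (1 + t) ^+ n = \sum_(G : {set 'I_n}) t ^+ #|G|.
  rewrite -[in LHS](card_ord n) -prodr_const.
  under eq_bigr do rewrite addrC.
  rewrite bigA_distr; apply: eq_bigr => G _.
  by rewrite -big_mkcond /= prodr_const.
rewrite -sum1_card natr_sum mulr_suml [leLHS]big_mkcond /=.
apply: ler_sum => G _; case: ifP; rewrite inE => Gr; last exact/exprn_ge0/ltW.
by rewrite mul1r ler_wiXn2l// ltW.
Qed.

(** * Return times and the coding of visits *)

Lemma recurrent_return (X : topologicalType) (T : homeomorphism X) (x : X) :
  recurrent T x ->
  (forall U, nbhs x U -> exists2 n, (0 < n)%N & U (iter n T x)) \/
  (forall U, nbhs x U -> exists2 n, (0 < n)%N & U (iter n (homeo_inv T) x)).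
Proof.
case=> u [uoo ux]; case: uoo => uoo; [left|right] => U xU.
  (* The bounds 1 here and -1 below exclude a return at time 0. *)
  have [i [/= + Uui]] := filter_ex (filterI (uoo 1) (ux _ xU)).
  by move: Uui; case: (u i) => [[|n]|n] //= Un _; exists n.+1.
have [i [/= + Uui]] := filter_ex (filterI (uoo (-1)) (ux _ xU)).
by move: Uui; case: (u i) => [n|n] //= Un _; exists n.+1.
Qed.

Lemma continuous_iter (X : topologicalType) (f : X -> X) (n : nat) :
  continuous f -> continuous (iter n f).
Proof.
move=> cf; elim: n => [|n IH] x; first exact: cvg_id.
exact: (continuous_comp (IH x) (cf _)).
Qed.

(* Prepending 0 to a translate of [s] by a return time adds only differences
   that are again return times, as in the construction of IP sets. *)
Lemma return_gaps (X : topologicalType) (f : X -> X) (x : X) (m : nat) (U : set X) :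
  continuous f ->
  (forall V, nbhs x V -> exists2 n, (0 < n)%N & V (iter n f x)) ->
  nbhs x U ->
  exists s, [/\ uniq s, size s = m.+1, 0%N \in s &
    forall b c, b \in s -> c \in s -> (c < b)%N -> U (iter (b - c) f x)].
Proof.
move=> cf xret; rewrite nbhsE => -[V [oV Vx] VU].
suff [s [us sm s0 sV]] : exists s, [/\ uniq s, size s = m.+1, 0%N \in s &
    forall b c, b \in s -> c \in s -> (c < b)%N -> V (iter (b - c) f x)].
  by exists s; split=> // b c bs cs cb; exact/VU/sV.
elim: m => [|m [s [us sm s0 sV]]].
  by exists [:: 0%N]; split=> // b c; rewrite !inE => /eqP-> /eqP->.
have Vs b : b \in s -> V (iter b f x).
  case: b => [//|b] bs; by have := sV _ _ bs s0 isT; rewrite subn0.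
(* By continuity, one return time [n] puts f^b (f^n x) in [V] for all b in [s] at once. *)
have [|n n0 nV] := xret [set y | forall b : seq_sub s, V (iter (val b) f y)].
  apply: filter_forall => b; apply: continuous_iter => //.
  exact: open_nbhs_nbhs (conj oV (Vs _ (valP b))).
exists (0%N :: map (addn n) s); split; rewrite ?inE//=.
- rewrite map_inj_uniq ?us; last exact: addnI.
  by rewrite andbT; apply/negP => /mapP[b _]; lia.
- by rewrite size_map sm.
- move=> b c; rewrite !inE => /orP[/eqP->//|/mapP[b' b's ->]].
  move=> /orP[/eqP->|/mapP[c' c's ->]] cb.
    by rewrite subn0 addnC iterD; exact: (nV (SeqSub b's)).
  by rewrite subnDl; apply: sV => //; lia.
Qed.

Lemma iter_hyper_map (R : realType) (X : compactMetricType R) (f : X -> X)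
    (cf : continuous f) (n : nat) (A : hyperspace X) :
  hyper_set (iter n (hyper_map cf) A) = iter n f @` A.
Proof.
elim: n => [|n /= ->]; first by rewrite image_id.
by rewrite image_comp.
Qed.

Lemma iter_cancel (X : Type) (f g : X -> X) (n i : nat) (x : X) :
  cancel f g -> (n <= i)%N -> iter n g (iter i f x) = iter (i - n) f x.
Proof.
move=> fK ni; rewrite -{1}(subnK ni) addnC iterD.
by elim: n {ni} (iter _ f x) => // n IH y; rewrite iterSr /= fK.
Qed.

(* [G] encodes the visits of [C] to [A]; the decoder, independent of [C],
   may also output times at which [C] is merely [e]-close to [A]. *)
Lemma visits_code (R : realType) (X : compactMetricType R)
    (T : homeomorphism X) (A : hyperspace X) (e : R) (m : nat) :
  recurrent (hyper_homeo T) A -> 0 < e ->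
  exists S, forall n, exists dec : {set 'I_n} -> {set 'I_n},
  forall C : set X, exists G : {set 'I_n}, [/\ (#|G| * m.+1 <= n + S)%N,
    forall (i : 'I_n) x, C x -> hyper_set A (iter i T x) -> i \in dec G &
    forall i : 'I_n, i \in dec G ->
      exists2 x, C x & exists2 a, hyper_set A a & mdist a (iter i T x) < e].
Proof.
move=> /recurrent_return recA e0.
(* [f] is [T] or its inverse, according to the direction in which [A] returns; [dir] records
   which. *)
have [f [cf [Aret [dir fdir]]]] : exists (f : X -> X) (cf : continuous f),
    (forall U, nbhs A U ->
      exists2 n, (0 < n)%N & U (iter n (hyper_map cf) A)) /\
    exists dir : bool, forall (i j d : nat) x,
      (if dir then j = i + d else i = j + d)%N ->
      iter d f (iter i T x) = iter j T x.
  case: recA => Aret.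
    exists T, (@homeo_continuous _ T); split => //; exists true => i j d x ->.
    by rewrite -iterD addnC.
  exists (homeo_inv T), (@homeo_inv_continuous _ T); split => //.
  exists false => i j d x ->; rewrite (iter_cancel _ (@homeo_funK _ T)); last lia.
  by congr iter; lia.
have [s [us sm _ sA]] := return_gaps m (@hyper_map_continuous _ _ _ cf) Aret (nbhsx_ballx A e e0).
exists (\max_(b <- s) b) => n.
pose r (i j : 'I_n) := if dir then gap_rel s i j else gap_rel s j i.
(* The decoder adds to [G] every time at which a visit in [G] forces an approximate visit. *)
exists (fun G : {set 'I_n} => [set j | (j \in G) || [exists i in G, r i j]]%SET) => C.
pose E := [set i : 'I_n | `[< exists2 x, C x & hyper_set A (iter i T x) >]]%SET.
(* When [f] is the inverse of [T], forced times are earlier, so the key reverses time. *)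
have rkey i j : r i j -> ((if dir then i : nat else n - i) < (if dir then j : nat else n - j))%N.
  rewrite /r; case: dir {fdir r} => /gap_relP [b [c [_ _ cb e']]]; first lia.
  by have := ltn_ord i; lia.
have [G [/fintype.subsetP GE Gd Gi]] := kernel_exists E rkey.
exists G; split.
- rewrite -sm; apply: gap_free_card => //.
    by move=> b bs; apply: leq_bigmax_seq.
  by move=> i j iG jG; have := Gi _ _ iG jG; have := Gi _ _ jG iG; rewrite /r; case: dir {fdir r rkey Gd Gi}.
- move=> i x Cx Ax; rewrite inE; case: (Gd i).
  + by rewrite inE; apply/asboolP; exists x.
  + by move->.
  + by move=> [j jG ji]; apply/orP; right; apply/existsP; exists j; rewrite jG.
- move=> i; rewrite inE => /orP[/GE|/existsP[j /andP[/GE]]].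
    rewrite inE => /asboolP[x Cx Ax]; exists x => //.
    by exists (iter i T x) => //; rewrite mdistxx.
  rewrite inE => /asboolP[x Cx Ax] rji; exists x => //.
  have [d [b [c [[bs cs cb dE] ijd]]]] : exists d, exists b, exists c,
      [/\ b \in s, c \in s, (c < b)%N & d = (b - c)%N] /\
      (if dir then i = j + d :> nat else j = i + d :> nat)%N.
    move: rji; rewrite /r; case: dir {fdir r rkey Gd Gi} => /gap_relP [b [c [bs cs cb e']]];
    by exists (b - c)%N, b, c.
  (* As T^j x is in [A], T^i x lies in f^d A, which is [e]-close to [A]. *)
  have := sA _ _ bs cs cb; rewrite -dE ballEmdist /= metric_sym => h.
  have [|a Aa ha] := hausdorff_dist_lt h (a := iter i T x).
    rewrite iter_hyper_map; exists (iter j T x) => //; exact: fdir.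
  by exists a => //; rewrite metric_sym.
Qed.

(** * Subexponential growth *)

Lemma ln_nat_ge0 (R : realType) (n : nat) : 0 <= ln n%:R :> R.
Proof. by case: n => [|n]; [rewrite ln0|rewrite ln_ge0// ler1n]. Qed.

(** After logarithms, the bound of [small_sets_card] costs k (n t + r L) with L = - ln t. First t is
    made small, which fixes L; then m is taken so large that r, about n / m, makes the second term
    small. *)
Lemma subexponential (R : realType) (a : nat -> nat) (k : nat) :
  (forall m, exists S, forall n,
    (a n <= #|[set G : {set 'I_n} | (#|G| * m.+1 <= n + S)%N]%SET| ^ k)%N) ->
  (fun n => (ln (a n)%:R / n%:R : R)) @ \oo --> (0 : R).
Proof.
move=> ha; apply/cvgr0Pnorm_le => e e0.
pose t : R := Num.min 1 (e / (2 * k.+1%:R)).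
have t0 : 0 < t by rewrite lt_min ltr01 divr_gt0// mulr_gt0.
have t1 : t <= 1 by rewrite ge_min lexx.
have kt : k%:R * t <= e / 2.
  have : k.+1%:R * t <= e / 2.
    rewrite mulrC -ler_pdivlMr// /t ge_min; apply/orP; right.
    by rewrite invfM mulrA.
  by apply: le_trans; rewrite ler_wpM2r ?ler_nat// ltW.
pose L := - ln t; have L0 : 0 <= L by rewrite oppr_ge0 ln_le0.
have [m hm] : exists m : nat, 2 * k%:R * L / m.+1%:R <= e / 2.
  exists (Num.truncn (2 * k%:R * L / (e / 2))).
  rewrite ler_pdivrMr// [leRHS]mulrC -ler_pdivrMr ?divr_gt0//.
  by apply/ltW/truncnS_gt.
(* For n >= S one has n + S <= 2 n, whence the factor 2 in the choice of m. *)
have [S hS] := ha m; exists (maxn 1 S) => //= n /=; rewrite geq_max => /andP[n1 Sn].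
have n0 : 0 < n%:R :> R by rewrite ltr0n.
rewrite ger0_norm ?divr_ge0 ?ln_nat_ge0// ler_pdivrMr//.
have [->|an0] := eqVneq (a n) 0%N; first by rewrite ln0// ltW// mulr_gt0.
pose r := ((n + S) %/ m.+1)%N.
have rn : r%:R <= 2 * n%:R / m.+1%:R :> R.
  rewrite ler_pdivlMr// -!natrM ler_nat.
  by apply: leq_trans (leq_divM _ _) _; lia.
have an : (a n)%:R <= ((1 + t) ^+ n * t ^- r) ^+ k :> R.
  have rE : [set G : {set 'I_n} | (#|G| * m.+1 <= n + S)%N]%SET =
      [set G : {set 'I_n} | (#|G| <= r)%N]%SET.
    by apply/finset.setP => G; rewrite !inE leq_divRL.
  apply: (@le_trans _ _ (#|[set G : {set 'I_n} | (#|G| <= r)%N]%SET|%:R ^+ k)).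
    by rewrite -natrX ler_nat -rE.
  rewrite lerXn2r ?nnegrE ?ler0n//.
    by rewrite divr_ge0 ?exprn_ge0// ?addr_ge0// ltW.
  by apply: small_sets_card; rewrite t0.
have t1p : 0 < 1 + t by rewrite addr_gt0.
have : ln (a n)%:R <= k%:R * (n%:R * t + r%:R * L).
  apply: (@le_trans _ _ (ln (((1 + t) ^+ n * t ^- r) ^+ k))).
    by rewrite ler_ln// posrE ?ltr0n ?lt0n// exprn_gt0// divr_gt0// exprn_gt0.
  rewrite lnXn ?divr_gt0 ?exprn_gt0// -[X in X <= _]mulr_natl ler_wpM2l//.
  rewrite ln_div ?posrE ?exprn_gt0// !lnXn// /L mulrN lerD//; last by rewrite mulr_natl.
  by rewrite -[X in X <= _]mulr_natl ler_wpM2l// le_ln1Dx// (lt_trans _ t0)// ltrN10.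
move=> /le_trans; apply; rewrite mulrDr.
have -> : e * n%:R = n%:R * (e / 2) + n%:R * (e / 2) by lra.
apply: lerD.
  by rewrite mulrCA ler_wpM2l.
apply: (le_trans (_ : _ <= k%:R * (2 * n%:R / m.+1%:R * L))).
  by rewrite ler_wpM2l// ler_wpM2r.
have -> : k%:R * (2 * n%:R / m.+1%:R * L) = n%:R * (2 * k%:R * L / m.+1%:R) by ring.
by rewrite ler_wpM2l.
Qed.

(** * Lebesgue numbers and finite nets *)

Lemma lebesgue_number (R : realType) (X : compactMetricType R) (U : set (set X)) :
  open_cover U ->
  exists2 d : R, 0 < d & forall x, exists2 V, U V & ball x d `<=` V.
Proof.
move=> [oU cU]; have /compact_near_coveringP cX := @compact_setT R X.
have := cX R (0^'+) (fun d x => exists2 V, U V & ball x d `<=` V) _.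
have H x : [set: X] x -> \forall x' \near x & d \near (0:R)^'+,
    exists2 V, U V & ball x' d `<=` V.
  rewrite -cU => -[V UV Vx]; have /nbhs_ballP[r /= r0 rV] := open_nbhs_nbhs (conj (oU _ UV) Vx).
  (* One half of [r] absorbs the move from x to x', the other the radius [d]. *)
  exists (ball x (r / 2), [set d | d < r / 2]) => /=.
    by split; [apply: nbhsx_ballx; rewrite divr_gt0|apply: nbhs_right_lt; rewrite divr_gt0].
  move=> [x' d] /= [xx' dr]; exists V => // y x'y; apply/rV.
  by apply: ball_split xx' _; apply: le_ball x'y; exact: ltW.
move=> /(_ _ H) h; near (0:R)^'+ => d; exists d => // x.
by apply: (near h d).
Unshelve. all: by end_near. Qed.

Lemma finite_net (R : realType) (X : compactMetricType R) (e : R) : 0 < e ->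
  exists (I : finType) (c : I -> X), forall x, exists i, mdist (c i) x < e.
Proof.
move=> e0; have /compact_near_coveringP cX := @compact_setT R X.
(* Along [F] finite lists grow by inclusion, so near-covering compactness yields a finite net. *)
pose F := filter_from [set: seq X] (fun s => [set t : seq X | {subset s <= t}]).
have FF : Filter F.
  apply: filter_from_filter => [|s t _ _]; first by exists [::].
  exists (s ++ t) => // u /= stu.
  by split=> x xs; apply: stu; rewrite mem_cat xs ?orbT.
have [x _|s _ sP] := cX _ F (fun s x => exists2 c, c \in s & mdist c x < e) FF.
  exists (ball x e, [set s : seq X | x \in s]) => /=.
    split; first exact: nbhsx_ballx.
    by exists [:: x] => // s /= xs; apply: xs; rewrite inE.
  by move=> [y s] /= [+ xs]; rewrite ballEmdist => xy; exists x.
exists (seq_sub s), val => x; have [c cs cx] := sP s (fun _ => id) x I.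
by exists (SeqSub cs).
Qed.

Lemma closed_cball (R : realType) (X : metricType R) (x : X) (e : R) :
  closed [set y | mdist x y <= e].
Proof.
move=> y cy; apply/ler_addgt0Pr => r r0.
have [z [/= xz yz]] := cy _ (nbhsx_ballx y r r0).
rewrite ballEmdist /= metric_sym in yz.
by apply: (le_trans (metric_triangle x z y)); rewrite lerD// ltW.
Qed.

(** * Sizes of subcovers of joins *)

Lemma min_subcover_le (X : topologicalType) (U : set (set X)) n :
  subcover_size U n -> (min_subcover U <= n)%N.
Proof.
move=> Un; have exU : exists k, `[< subcover_size U k >] by exists n; apply/asboolP.
(* A nonempty set of sizes has a least element, so the default of [xget] does not occur. *)
rewrite /min_subcover; case: xgetP => [k _ [_ /(_ _ Un)//]|/(_ (ex_minn exU))].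
case; case: ex_minnP => k /asboolP Uk kmin; split => // j /asboolP; exact: kmin.
Qed.

(** The [V i] may coincide while [subcover_size] counts distinct sets, so the bound goes through the
    cardinality of their image. *)
Lemma min_subcover_family (X : topologicalType) (U : set (set X)) (I : finType)
    (Q : {set I}) (V : I -> set X) :
  (forall i, i \in Q -> U (V i)) -> (forall x, exists2 i, i \in Q & V i x) ->
  (min_subcover U <= #|Q|)%N.
Proof.
move=> UV cV; pose g j := if insub j is Some j' then V (@enum_val _ (mem Q) j') else set0.
have gE (j : 'I_#|Q|) : g j = V (enum_val j) by rewrite /g valK.
have /finite_setP[n gn] : finite_set (g @` `I_#|Q|) by exact: finite_image.
apply: (@leq_trans n); last first.
  rewrite -card_le_II; apply: card_le_trans (card_image_le g _).
  by move: gn; rewrite card_eq_le => /andP[].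
apply: min_subcover_le; exists (g @` `I_#|Q|); split => //.
- move=> _ [j /= jQ <-]; rewrite (gE (Ordinal jQ)); exact/UV/enum_valP.
- apply/seteqP; split => // x _; have [i iQ Vx] := cV x.
  exists (V i) => //; exists (enum_rank_in iQ i) => /=; first exact: ltn_ord.
  by rewrite gE enum_rankK_in.
Qed.

Lemma iter_joinI (X : topologicalType) (f : X -> X) (U : set (set X)) (n : nat)
    (V : 'I_n -> set X) :
  (forall i, U (V i)) ->
  iter_join f U n (\big[setI/setT]_(i < n) (iter i f @^-1` V i)).
Proof.
move=> UV; rewrite /iter_join; elim/big_rec2: _ => //= i A P _ PA.
by exists (iter i f @^-1` V i); [exists (V i)|exists A].
Qed.

Lemma min_subcover_join (R : realType) (X : compactMetricType R)
    (T : homeomorphism X) (U : set (set (hyperspace X))) :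
  pointwise_recurrent (hyper_homeo T) -> open_cover U ->
  exists k, forall m, exists S, forall n,
    (min_subcover (iter_join (hyper_homeo T) U n) <=
      #|[set G : {set 'I_n} | (#|G| * m.+1 <= n + S)%N]%SET| ^ k)%N.
Proof.
(* A common code leaves three errors of [e]: from T^j x to a centre, from there to a point a of its
   ball, from a to T^j y. Their sum 3 e is below [d]. *)
move=> recT /lebesgue_number[d d0 dU]; pose e := d / 4.
have e0 : 0 < e by rewrite divr_gt0.
(* The net is chosen before m, so k does not depend on m. *)
have [I [c cX]] := @finite_net R X e e0; exists #|I| => m.
have A0 i : [set y | mdist (c i) y <= e] !=set0.
  by exists (c i); rewrite /= mdistxx ltW.
pose A i := Hyperspace (closed_cball (x := c i) (e := e)) (A0 i).
have [S_ /= hS] := choice (fun i => visits_code m (recT (A i)) e0).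
exists (\max_i S_ i) => n.
have [dec hdec] := choice (fun i => hS i n).
pose codes (C : set X) (g : {ffun I -> {set 'I_n}}) := forall i,
  (forall (j : 'I_n) x, C x -> mdist (c i) (iter j T x) <= e -> j \in dec i (g i)) /\
  (forall j : 'I_n, j \in dec i (g i) -> exists2 x, C x &
    exists2 a, mdist (c i) a <= e & mdist a (iter j T x) < e).
pose small := [set G : {set 'I_n} | (#|G| * m.+1 <= n + \max_i S_ i)%N]%SET.
(* Only codes of actual sets are kept: each then has a representative around which a member of the
   join is built. *)
pose Q := [set g : {ffun I -> {set 'I_n}} | (g \in ffun_on (mem small)) &&
  `[< exists C : hyperspace X, codes C g >]]%SET.
have exQ (C : hyperspace X) : exists2 g, g \in Q & codes C g.
  have [g hg] := choice (fun i => hdec i C).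
  have cg : codes C (finfun g).
    by move=> i; rewrite ffunE; have [_ h1 h2] := hg i; split.
  exists (finfun g) => //; rewrite inE; apply/andP; split; last by apply/asboolP; exists C.
  apply/ffun_onP => i; rewrite ffunE inE; have [h _ _] := hg i.
  by apply: leq_trans h _; rewrite leq_add2l; exact: leq_bigmax.
have close (C D : hyperspace X) g (j : 'I_n) : codes C g -> codes D g ->
    ball (iter j (hyper_homeo T) C) d (iter j (hyper_homeo T) D).
  move=> gC gD; have near (E F : hyperspace X) : codes E g -> codes F g ->
      forall a, (iter j T @` E) a -> exists2 b, (iter j T @` F) b & mdist a b <= 3 * e.
    move=> gE gF _ [x Ex <-]; have [i /ltW xi] := cX (iter j T x).
    have [y Fy [a ia ay]] := (gF i).2 j ((gE i).1 j x Ex xi).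
    exists (iter j T y); first by exists y.
    have := metric_triangle (iter j T x) (c i) (iter j T y).
    have := metric_triangle (c i) a (iter j T y).
    by rewrite [mdist (iter j T x) (c i)]metric_sym; lra.
  rewrite ballEmdist /= mdist_hyperE; apply: (@le_lt_trans _ _ (3 * e)).
    by apply: hausdorff_dist_le; rewrite !iter_hyper_map; exact: near.
  by rewrite /e; lra.
have /choice[V hV] : forall g, exists V, g \in Q ->
    iter_join (hyper_homeo T) U n V /\ forall C : hyperspace X, codes C g -> V C.
  move=> g; have [gQ|] := boolP (g \in Q); last by exists set0.
  move: gQ; rewrite inE => /andP[_ /asboolP[C gC]].
  (* By the choice of [d], one member of [U] contains the [d]-ball around T^j C, hence T^j D for
     every D with code [g]. *)
  have /choice[W hW] : forall j : 'I_n, exists W, U W /\ ball (iter j (hyper_homeo T) C) d `<=` W.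
    by move=> j; have [W UW] := dU (iter j (hyper_homeo T) C); exists W.
  exists (\big[setI/setT]_(j < n) (iter j (hyper_homeo T) @^-1` W j)) => _; split.
    by apply: iter_joinI => j; have [] := hW j.
  move=> D gD; elim/big_ind: _ => // j _.
  by have [_] := hW j; apply; exact: close gC gD.
apply: (@leq_trans #|Q|).
  apply: (@min_subcover_family _ _ _ Q V) => [g /hV[]//|C].
  by have [g gQ gC] := exQ C; exists g => //; have [_] := hV g gQ; apply.
rewrite -card_ffun_on; apply: subset_leq_card; apply/fintype.subsetP => g.
by rewrite inE => /andP[].
Qed.

Theorem corollary5p8 (R : realType) (X : compactMetricType R)
    (T : homeomorphism X) :
  pointwise_recurrent (hyper_homeo T) ->
  top_entropy (hyper_homeo T) = 0%E.
Proof.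
move=> recT; have entropy0 U : open_cover U ->
    cover_entropy (R := R) (hyper_homeo T) U = 0%E.
  move=> /(min_subcover_join recT)[k hk]; rewrite /cover_entropy.
  apply: (cvg_limn_einf_sup _).2.
  apply: cvg_EFin; first exact: nearW.
  exact: subexponential hk.
(* Some open cover must be exhibited, as the supremum of the empty set is -oo. *)
have cT : open_cover [set [set: hyperspace X]].
  by split=> [_ ->|]; [exact: openT|rewrite bigcup_set1].
rewrite /top_entropy (_ : [set _ | _ in _] = [set 0%E]) ?ereal_sup1//.
apply/seteqP; split=> [_ [U /entropy0-> <-]//|_ ->].
by exists [set setT] => //; exact: entropy0.
Qed.
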